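(* Let $r\ge 2$ be a prime, and let $k\ge 1$ and $n\ge rk$ be integers. Let $C_1\sqcup\dots\sqcup C_m$ be a partition of $[n]$ with $|C_i|\le r-1$ for all $i$. Let $H$ be the subhypergraph of $\mathrm{KG}^r(k,n)$ induced by those $k$-sets $\sigma\subset[n]$ that are almost $2$-stable and satisfy $|\sigma\cap C_i|\le 1$ for all $i$. Then $\chi(H)=\big\lceil \frac{n-r(k-1)}{r-1}\big\rceil$.
   Context: For integers $r\ge 2$, $k\ge1$, $n\ge1$, the Kneser hypergraph $\mathrm{KG}^r(k,n)$ has as vertex set the $k$-element subsets of $[n]=\{1,\dots,n\}$, and a hyperedge for every $r$ pairwise disjoint such $k$-sets. The chromatic number $\chi(H)$ of a hypergraph $H$ is the least number of colors needed to color its vertices so that no hyperedge is monochromatic. A set $\sigma\subset[n]$ is almost $2$-stable if $|i-j|\ne 1$ for all $i,j\in\sigma$ (i.e. it contains no two consecutive integers, but may contain both $1$ and $n$). *)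

(* Defs.v *)
From mathcomp Require Import all_boot all_order all_algebra.

Set Implicit Arguments.
Unset Strict Implicit.
Unset Printing Implicit Defensive.

Record hypergraph (T : finType) := Hypergraph {
  vertices : {set T};
  hyperedges : {set {set T}}
}.

(* The set {1, ..., n} is represented by 'I_n = {0, ..., n - 1}. For k >= 1,
   a trivIset of cardinality r whose members are k-sets is the same thing as
   r pairwise disjoint k-sets. *)
Definition kneser_hypergraph (r k n : nat) : hypergraph {set 'I_n} :=
  let V := [set s : {set 'I_n} | #|s| == k] in
  Hypergraph V
    [set e : {set {set 'I_n}} | [&& e \subset V, #|e| == r & trivIset e]].

Definition induced (T : finType) (H : hypergraph T) (W : {set T}) :
    hypergraph T :=
  Hypergraph (vertices H :&: W) [set e in hyperedges H | e \subset W].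

Definition monochromatic (T : finType) (f : T -> nat) (e : {set T}) : Prop :=
  {in e &, forall u v, f u = f v}.

(* Only the colors of vertices of H matter; the values of f elsewhere are
   unconstrained. *)
Definition proper_coloring (T : finType) (H : hypergraph T) (c : nat)
    (f : T -> nat) : Prop :=
  {in vertices H, forall v, f v < c} /\
  {in hyperedges H, forall e, ~ monochromatic f e}.

Definition colorable (T : finType) (H : hypergraph T) (c : nat) : Prop :=
  exists f : T -> nat, proper_coloring H c f.

(* A relation rather than a function, since a hypergraph with a hyperedge of
   size at most 1 has no proper coloring at all. *)
Definition is_chromatic_number (T : finType) (H : hypergraph T) (c : nat) :
    Prop :=
  colorable H c /\ forall c', colorable H c' -> c <= c'.

Definition almost_2stable (n : nat) (s : {set 'I_n}) : bool :=
  [forall i in s, forall j in s, `|i - j|%N != 1].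

(* P is the set of parts of a partition of 'I_n. *)
Definition partial_transversal (n : nat) (P : {set {set 'I_n}}) (s : {set 'I_n}) :
    bool :=
  [forall C in P, #|s :&: C| <= 1].

(* Main.v *)
Require Import Defs.
From mathcomp Require Import all_boot all_order all_fingroup all_algebra.
From mathcomp Require Import pgroup zify.

Set Implicit Arguments.
Unset Strict Implicit.
Unset Printing Implicit Defensive.

Import Order.TTheory GRing.Theory Num.Theory.

Local Open Scope ring_scope.

(* The upper bound is the usual coloring by blocks of r - 1 consecutive minima.

   For the lower bound, call a partial map from [n] to Z/r injective on every
   part of the partition a face: faces form a join of chessboard complexes on
   which Z/r acts by translation of the values. A coloring with m colors gives
   every face X a level, namely min(number of runs of X, r(k-1)) plus the number
   of pairs (g, c) such that the fiber of X at g contains a vertex of color c,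
   and an equivariant sign in Z/r; the level is at most r(k-1) + m(r-1), it is
   monotone, and nested faces of the same level have the same sign. A fiber of
   a face meets every part at most once, and a face with more than r(k-1) runs
   has a fiber containing an almost 2-stable k-set.

   It remains to see that some face has level at least n (a Tucker-type lemma).
   From the sign one builds cochains a_i on the faces of size i with
   d a_i = N a_(i+1) or d a_i = (1 - t) a_(i+1) alternately, N being the norm and
   t a generator of Z/r, in such a way that a_i(X) <> 0 forces the level of X to
   be at least i. The chessboard complexes are not highly connected, but
   averaging over the permutations of [n] preserving the parts, whose number is
   prime to r as all parts have less than r elements, transports the a_i to
   the join of n copies of Z/r, where explicit cones show that a_n <> 0. *)

(** * Coboundaries of cochains on sequences, and alternating cochains *)

Section Coboundary.

Variables (T : eqType) (R : zmodType).
Implicit Types (f g : seq T -> R) (y z : seq T).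

(** Simplices are ordered sequences. Deleting the head gives the first term; deletions further right
    keep the head and change sign, so this is the alternating sum over all one-entry deletions. *)
Fixpoint cobd f y : R :=
  if y is z :: y' then f y' - cobd (fun u => f (z :: u)) y' else 0.

Lemma cobd_ext f g y :
  (forall z, subseq z y -> (size z).+1 = size y -> f z = g z) ->
  cobd f y = cobd g y.
Proof.
elim: y f g => //= x y IHy f g fg; congr (_ - _).
  by apply: fg => //; exact: subseq_cons.
apply: IHy => z zy sz; apply: fg; last by rewrite /= sz.
by rewrite /= eqxx.
Qed.

Lemma cobd0 y : cobd (fun=> 0) y = 0.
Proof. by elim: y => //= x y ->; rewrite subr0. Qed.

Lemma cobdD f g y : cobd (fun u => f u + g u) y = cobd f y + cobd g y.
Proof. by elim: y f g => [|x y IHy] f g /=; rewrite ?addr0 // IHy opprD addrACA. Qed.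

Lemma cobdN f y : cobd (fun u => - f u) y = - cobd f y.
Proof. by elim: y f => [|x y IHy] f /=; rewrite ?oppr0 // IHy opprD. Qed.

Lemma cobdB f g y : cobd (fun u => f u - g u) y = cobd f y - cobd g y.
Proof. by rewrite cobdD cobdN. Qed.

Lemma cobd_sum (I : Type) (r : seq I) (P : pred I) (F : I -> seq T -> R) y :
  cobd (fun u => \sum_(i <- r | P i) F i u) y =
  \sum_(i <- r | P i) cobd (F i) y.
Proof.
elim: y F => [|x y IHy] F /=; first by rewrite big1.
by rewrite IHy sumrB.
Qed.

Lemma cobd_cobd f y : cobd (cobd f) y = 0.
Proof.
elim: y f => //= x y IHy f.
by rewrite cobdB IHy subr0 subrr.
Qed.

Lemma cobd_neq0 f y : cobd f y != 0 ->
  exists2 z, subseq z y & (size z).+1 = size y /\ f z != 0.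
Proof.
elim: y f => [|x y IHy] f /=; first by rewrite eqxx.
have [fy0|fy0 _] := eqVneq (f y) 0; last by exists y => //; exact: subseq_cons.
rewrite fy0 sub0r oppr_eq0 => /IHy[z zy [sz fz]].
by exists (x :: z); rewrite /= ?eqxx // sz.
Qed.

Definition antisym f := forall y1 a b y2,
  f (y1 ++ a :: b :: y2) = - f (y1 ++ b :: a :: y2).

Lemma antisym_cons f a : antisym f -> antisym (fun u => f (a :: u)).
Proof. by move=> fA y1 b c y2; apply: (fA (a :: y1)). Qed.

Lemma antisym_cobd f : antisym f -> antisym (cobd f).
Proof.
move=> fA y1; elim: y1 f fA => [|x y1 IHy] f fA a b y2 /=.
  rewrite (@cobd_ext _ (fun u => - f (b :: a :: u))).
    by rewrite cobdN opprK opprB opprD addrA addrAC.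
  by move=> z _ _; apply: (fA [::]).
by rewrite fA (IHy _ (antisym_cons x fA)) opprB opprK addrC.
Qed.

Lemma antisym_move f y1 a y2 : antisym f ->
  (f (y1 ++ a :: y2) == 0) = (f (a :: y1 ++ y2) == 0).
Proof.
move=> fA; elim/last_ind: y1 y2 => //= y1 b IHy y2.
by rewrite !cat_rcons fA oppr_eq0 IHy.
Qed.

(** Reordering an alternating cochain only changes its sign. This brings a conflicting pair to the
    front before the coboundary is expanded in [cobd_symcochain]. *)
Lemma antisym_move2 f y a b : antisym f -> a \in y -> b \in y -> a != b ->
  exists2 z, perm_eq y (a :: b :: z) & (f y == 0) = (f (a :: b :: z) == 0).
Proof.
move=> fA /splitPr[y1 y2]; rewrite mem_cat inE => b_y aNb.
have {b_y}: b \in y1 ++ y2.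
  by move: b_y; rewrite mem_cat eq_sym (negbTE aNb).
rewrite antisym_move // => b_y.
have: perm_eq (y1 ++ a :: y2) (a :: y1 ++ y2) by rewrite -cat1s perm_catCA.
move: (y1 ++ y2) b_y => u b_u; case/splitPr: b_u => z1 z2 Ey.
exists (z1 ++ z2); last by rewrite (antisym_move _ _ _ (antisym_cons a fA)).
by apply: perm_trans Ey _; rewrite perm_cons -cat1s perm_catCA.
Qed.

End Coboundary.

Lemma cobd_map (T U : eqType) (R : zmodType) (h : T -> U) (f : seq U -> R) y :
  cobd f (map h y) = cobd (fun u => f (map h u)) y.
Proof. by elim: y f => //= x y IHy f; rewrite IHy. Qed.

(** * The group of permutations preserving every block *)

Section BlockPerm.

Variables (V : finType) (B : eqType) (blk : V -> B).

Definition block_perms := [set u : {perm V} | [forall v, blk (u v) == blk v]].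

Lemma block_permsP (u : {perm V}) :
  reflect (forall v, blk (u v) = blk v) (u \in block_perms).
Proof. by rewrite inE; apply: (iffP forallP) => h v; apply/eqP. Qed.

Lemma block_perms_group_set : group_set block_perms.
Proof.
apply/group_setP; split; first by apply/block_permsP => v; rewrite perm1.
move=> u w /block_permsP uP /block_permsP wP.
by apply/block_permsP => v; rewrite permM wP uP.
Qed.

Canonical block_perms_group := Group block_perms_group_set.

(** Otherwise Cauchy's theorem gives an element of order [p]. Its orbits have size dividing [p] and
    lie in blocks of fewer than [p] points, so they are trivial and the element is the identity. *)
Lemma block_perms_coprime (p : nat) : prime p ->
  (forall v, #|[set u | blk u == blk v]| < p)%N -> ~~ (p %| #|block_perms|)%N.
Proof.
move=> p_pr small; apply/negP => /(Cauchy p_pr)[u /= uG ou].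
have uk k v : blk ((u ^+ k)%g v) = blk v.
  exact/block_permsP/groupX.
have ptv v : u v = v.
  have orb_sub : porbit u v \subset [set w | blk w == blk v].
    by apply/subsetP => w /porbitP[k ->]; rewrite inE uk.
  have orb_dvd : (#|porbit u v| %| p)%N.
    by rewrite -ou porbit.unlock; exact: (dvdn_orbit 'P).
  have: porbit u v = [set v].
    apply/eqP; rewrite eq_sym eqEcard sub1set porbit_id cards1 leqNgt.
    apply/negP => orb_gt1; have := small v.
    rewrite ltnNge -(prime_nt_dvdP p_pr _ orb_dvd) ?subset_leq_card //.
    by rewrite neq_ltn orb_gt1 orbT.
  by move/setP/(_ (u v)); rewrite inE -{1}(expg1 u) mem_porbit => /esym/eqP.
have: (1 < #[u]%g)%N by rewrite ou prime_gt1.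
by rewrite (_ : u = 1%g) ?order1 //; apply/permP => v; rewrite perm1.
Qed.

End BlockPerm.

(** * Faces, and the action of the cyclic group of order [p] on them *)

Section EquivariantCochains.

Variables (p : nat) (V : finType) (B : eqType) (blk : V -> B).
Hypothesis p_pr : prime p.

Local Notation F := 'F_p.
Local Notation T := (V * 'F_p)%type.
Implicit Types (X : {set T}) (y z : seq T) (t : F).

Definition shift t (x : T) : T := (x.1, x.2 + t).

Lemma shift0 : shift 0 =1 id.
Proof. by case=> v g; rewrite /shift addr0. Qed.

Lemma shiftD t u x : shift t (shift u x) = shift (u + t) x.
Proof. by rewrite /shift addrA. Qed.

Lemma shift_inj t : injective (shift t).
Proof. by apply: (can_inj (g := shift (- t))) => x; rewrite shiftD subrr shift0. Qed.

Lemma map_shift0 y : map (shift 0) y = y.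
Proof. by rewrite (eq_map shift0) map_id. Qed.

Lemma map_shiftD t u y : map (shift t) (map (shift u) y) = map (shift (u + t)) y.
Proof. by rewrite -map_comp; apply: eq_map => x /=; rewrite shiftD. Qed.

Definition face X : bool :=
  [forall x in X, forall x' in X,
    (x.1 == x'.1) || (blk x.1 == blk x'.1) && (x.2 == x'.2) ==> (x == x')].

Lemma faceP X : reflect
  ({in X &, forall x x', x.1 = x'.1 -> x = x'} /\
   {in X &, forall x x', blk x.1 = blk x'.1 -> x.2 = x'.2 -> x = x'})
  (face X).
Proof.
apply: (iffP forall_inP) => [h | [h1 h2] x xX].
  split=> x x' /h/forall_inP/[apply]/implyP h' => [E1 | E1 E2]; apply/eqP/h'.
    by rewrite E1 eqxx.
  by rewrite E1 E2 !eqxx orbT.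
apply/forall_inP => x' x'X; apply/implyP => /orP[/eqP|/andP[/eqP E /eqP]] E'.
  by rewrite (h1 x x').
by rewrite (h2 x x').
Qed.

Lemma face_sub X X' : X \subset X' -> face X' -> face X.
Proof.
move=> /subsetP XX' /faceP[h1 h2]; apply/faceP.
by split=> x x' /XX' xX /XX' x'X; [apply: h1 | apply: h2].
Qed.

Lemma face_imset (h : T -> T) X :
  (forall x x', (h x).1 = (h x').1 -> x.1 = x'.1) ->
  (forall x x', blk (h x).1 = blk (h x').1 -> blk x.1 = blk x'.1) ->
  (forall x x', (h x).2 = (h x').2 -> x.2 = x'.2) ->
  face X -> face (h @: X).
Proof.
move=> H1 H2 H3 /faceP[h1 h2]; apply/faceP.
by split=> ? ? /imsetP[x xX ->] /imsetP[x' x'X ->]; [move/H1/h1-> | move/H2/h2=> E /H3/E->].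
Qed.

Lemma face_shift t X : face X -> face (shift t @: X).
Proof. by apply: face_imset => //= x x' /addIr. Qed.

(** Ordered nondegenerate simplices of the complex of faces. *)
Definition good y := uniq y && face [set x in y].

Lemma set_map (h : T -> T) y : [set x in map h y] = h @: [set x in y].
Proof.
apply/setP => x; rewrite inE.
apply/idP/idP => [/mapP[x' yx' ->]|/imsetP[x']]; first by rewrite imset_f ?inE.
by rewrite inE => yx' ->; apply: map_f.
Qed.

Lemma good_shift t y : good y -> good (map (shift t) y).
Proof.
case/andP=> uy fy; rewrite /good map_inj_uniq ?uy; last exact: shift_inj.
by rewrite set_map face_shift.
Qed.

Lemma good_shiftE t y : good (map (shift t) y) = good y.
Proof.
apply/idP/idP; last exact: good_shift.
by move/(good_shift (- t)); rewrite map_shiftD subrr map_shift0.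
Qed.

Lemma subseq_set y z : subseq z y -> [set x in z] \subset [set x in y].
Proof. by move=> zy; apply/subsetP => x; rewrite !inE; apply: mem_subseq. Qed.

Lemma good_subseq y z : subseq z y -> good y -> good z.
Proof.
move=> zy /andP[uy fy]; rewrite /good (subseq_uniq zy uy).
exact: face_sub (subseq_set zy) fy.
Qed.

Lemma perm_set y z : perm_eq y z -> [set x in y] = [set x in z].
Proof. by move=> yz; apply/setP => x; rewrite !inE (perm_mem yz). Qed.

Lemma perm_good y z : perm_eq y z -> good y = good z.
Proof. by move=> yz; rewrite /good (perm_uniq yz) (perm_set yz). Qed.

Lemma perm_swap (y1 y2 : seq T) a b :
  perm_eq (y1 ++ a :: b :: y2) (y1 ++ b :: a :: y2).
Proof. by rewrite perm_cat2l (perm_catCA [:: a] [:: b] y2). Qed.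

(* The boundary operators of the minimal free resolution of the cyclic group
   of order p, acting on cochains: the norm in odd degrees, and the difference
   of the identity and of the generator in positive even degrees. Degree 0 is
   set to the identity, which makes the recursion of [ev] below uniform. *)
Definition resop i (f : seq T -> F) y : F :=
  if i is 0 then f y else
  if odd i then \sum_(t : F) f (map (shift t) y)
  else f y - f (map (shift (-1)) y).

Lemma resop_odd i f y : odd i -> resop i f y = \sum_(t : F) f (map (shift t) y).
Proof. by case: i => // i; rewrite /resop => ->. Qed.

Lemma resop_even i f y : ~~ odd i.+1 ->
  resop i.+1 f y = f y - f (map (shift (-1)) y).
Proof. by rewrite /resop => /negbTE->. Qed.

Lemma cobd_resop i f y : cobd (resop i f) y = resop i (cobd f) y.
Proof.
case: i => // i; rewrite /resop; case: (odd _); last by rewrite cobdB cobd_map.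
by rewrite cobd_sum; apply: eq_bigr => t _; rewrite cobd_map.
Qed.

Lemma resopB i f g y :
  resop i (fun z => f z - g z) y = resop i f y - resop i g y.
Proof.
case: i => //= i; case: (odd i) => /=; last by rewrite sumrB.
by rewrite !opprD !opprK addrACA.
Qed.

(** The norm is unchanged by a shift, so it composes to zero with the difference on either side. *)
Lemma resop_resop i f y : (0 < i)%N -> resop i (resop i.+1 f) y = 0.
Proof.
case: i => //= i _; rewrite negbK; case: (odd i) => /=.
  apply/eqP; rewrite subr_eq0 eq_sym; apply/eqP.
  under eq_bigr do rewrite map_shiftD.
  by rewrite [RHS](reindex_inj (addrI (-1))).
rewrite sumrB; apply/eqP; rewrite subr_eq0; apply/eqP.
under [RHS]eq_bigr do rewrite map_shiftD.
by rewrite [LHS](reindex_inj (addIr (-1))).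
Qed.

Lemma resop_ext i f g y :
  (forall t, f (map (shift t) y) = g (map (shift t) y)) ->
  resop i f y = resop i g y.
Proof.
move=> fg; have fg0 : f y = g y by have := fg 0; rewrite map_shift0.
by case: i => //= i; case: (odd i) => /=; [rewrite fg0 fg | apply: eq_bigr].
Qed.

(** * Cochains built from an equivariant sign *)

Variable s : {set T} -> F.
Hypothesis s_shift : forall t X, face X -> X != set0 ->
  s (shift t @: X) = s X + t.

Local Notation sy y := (s [set x in y]).

(** Explicit solutions of the relation in [cobd_cochain]. The sign picks one representative, of sign
    0, in each orbit of the shifts. An equation with the norm is solved by restriction to
    representatives, one with the difference by summing over the elements of signs 1 to [sy y] in
    the orbit of [y]. *)
Fixpoint cochain i y : F :=
  if i is j.+1 then
    if good y then
      if odd i then (if sy y == 0 then cobd (cochain j) y else 0)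
      else \sum_(k < sy y) cobd (cochain j) (map (shift (- k%:R)) y)
    else 0
  else (y == [::])%:R.

Lemma sy_shift t y : good y -> (0 < size y)%N ->
  sy (map (shift t) y) = sy y + t.
Proof.
case/andP=> _ fy; case: y fy => // x y fy _; rewrite set_map s_shift //.
by apply/set0Pn; exists x; rewrite !inE eqxx.
Qed.

Lemma cochainS i y : good y -> cochain i.+1 y =
  if odd i.+1 then (if sy y == 0 then cobd (cochain i) y else 0)
  else \sum_(k < sy y) cobd (cochain i) (map (shift (- k%:R)) y).
Proof. by move=> /= ->. Qed.

Lemma cochain_bad i y : ~~ good y -> cochain i.+1 y = 0.
Proof. by move=> /= /negbTE->. Qed.

Local Arguments cochain : simpl never.

(** By induction, the coboundary of [cochain i.+1] is killed by [resop i.+1]. Either it is thus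
    shift-invariant, and the norm of its restriction to sign 0 gives it back, or its sum over each
    orbit is zero, and its partial sums along the orbit close up. *)
Lemma cobd_cochain i y : good y -> size y = i.+1 ->
  cobd (cochain i) y = resop i.+1 (cochain i.+1) y.
Proof.
elim: i y => [|i IHi] y gy szy.
  have cobd_y z : size z = 1 -> cobd (cochain 0) z = 1.
    by case: z => [|x []] //= _; rewrite subr0.
  rewrite cobd_y // resop_odd // (bigD1 (- sy y)) //= [X in _ + X]big1 => [|t tNs].
    rewrite cochainS ?good_shiftE //= sy_shift ?szy // subrr eqxx addr0.
    by rewrite cobd_y // size_map.
  rewrite cochainS ?good_shiftE //= sy_shift ?szy //.
  by rewrite addrC addr_eq0 (negbTE tNs).
(* Once the operators are commuted, the induction hypothesis turns this into a double coboundary. *)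
have closed t : resop i.+1 (cobd (cochain i.+1)) (map (shift t) y) = 0.
  rewrite -cobd_resop -[RHS](cobd_cobd (cochain i) (map (shift t) y)).
  apply: cobd_ext => z zy; rewrite size_map szy => -[szz].
  by rewrite IHi //; apply: good_subseq zy _; apply: good_shift.
set g := cobd (cochain i.+1) in closed *.
have [oi|ei] := boolP (odd i.+2).
  have ginv k : g (map (shift (- k%:R)) y) = g y.
    elim: k => [|k <-]; first by rewrite oppr0 map_shift0.
    have /eqP := closed (- k%:R).
    rewrite resop_even // subr_eq0 map_shiftD => /eqP->.
    by rewrite -opprD natr1.
  rewrite resop_odd // (bigD1 (- sy y)) //= [X in _ + X]big1 => [|t tNs].
    rewrite cochainS ?good_shiftE // oi sy_shift ?szy // subrr eqxx addr0.
    by rewrite -[sy y in RHS]natr_Zp -/g ginv.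
  rewrite cochainS ?good_shiftE // oi sy_shift ?szy //.
  by rewrite addrC addr_eq0 (negbTE tNs).
have gsum : \sum_(t : F) g (map (shift t) y) = 0.
  have odd_i1 : odd i.+1 by rewrite -[odd i.+1]negbK.
  by have := closed 0; rewrite map_shift0 resop_odd.
rewrite resop_even // !cochainS ?good_shiftE // (negbTE ei) -/g.
rewrite sy_shift ?szy //.
have sumS n : \sum_(k < n.+1) g (map (shift (- k%:R)) y) =
    g y + \sum_(k < n) g (map (shift (- k%:R)) (map (shift (-1)) y)).
  rewrite big_ord_recl oppr0 map_shift0; congr (_ + _).
  by apply: eq_bigr => k _; rewrite map_shiftD -opprD nat1r.
case Dn: (nat_of_ord (sy y)) (ltn_ord (sy y)) (natr_Zp (sy y)) => [|n] n_lt <-.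
  (* Wrap-around at sign 0: the predecessor has sign [p - 1], and its partial sum together with
     [g y] is the full orbit sum [gsum], which is zero. *)
  rewrite big_ord0 !add0r.
  have -> : (-1 : F) = (Zp_trunc (pdiv p)).+1 :> nat.
    by rewrite /= modn_small // subn1 modn_small.
  apply/eqP; rewrite -addr_eq0 -sumS -[X in _ == X]gsum; apply/eqP.
  rewrite [RHS](reindex_inj oppr_inj) /=.
  by apply: eq_bigr => k _; rewrite natr_Zp.
rewrite sumS -natr1 addrK.
rewrite (_ : nat_of_ord (n%:R : F) = n) ?addrK //.
by rewrite Zp_nat /= modn_small // ltnW.
Qed.

(* The value of a cochain at [y] only involves values at faces [z] of [y] with
   [s z <> s y]: this is why [k] ranges over [0, s y) in its definition. *)
Lemma cochain_neq0 (l : {set T} -> nat) i y :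
  (forall X, face X -> X != set0 -> 0 < l X)%N ->
  (forall t X, face X -> l (shift t @: X) = l X) ->
  (forall X X', X \subset X' -> X != set0 -> face X' ->
     (l X < l X')%N \/ l X = l X' /\ s X = s X') ->
  good y -> size y = i -> cochain i y != 0 -> (i <= l [set x in y])%N.
Proof.
move=> l_gt0 l_shift l_mono.
elim: i y => // i IHi y gy szy.
have y_n0 : [set x in y] != set0.
  by case: y szy {gy} => // x y _; apply/set0Pn; exists x; rewrite !inE eqxx.
case: i => [|i] in IHi szy *; first by move=> _; apply: l_gt0 => //; case/andP: gy.
have step z : subseq z y -> size z = i.+1 -> (i < l [set x in z])%N ->
    sy z != sy y -> (i.+1 < l [set x in y])%N.
  move=> zy szz lz sNs; have z_n0 : [set x in z] != set0.
    case: z szz {zy lz sNs} => // x z _.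
    by apply/set0Pn; exists x; rewrite !inE eqxx.
  have fy : face [set x in y] by case/andP: gy.
  have [/(leq_ltn_trans lz) //|[_ E]] := l_mono _ _ (subseq_set zy) z_n0 fy.
  by rewrite E eqxx in sNs.
have cochain_good z : cochain i.+1 z != 0 -> good z.
  by apply: contraNT => /cochain_bad->.
rewrite cochainS //; case: ifPn => [oi|ei].
  case: (sy y =P 0) => [sy0|_]; last by rewrite eqxx.
  case/cobd_neq0=> z zy [szz az]; have gz := cochain_good z az.
  have szz' : size z = i.+1 by move: szz; rewrite szy => -[].
  apply: (step z) => //; first exact: IHi.
  apply: contraNneq az; rewrite sy0 cochainS // => ->.
  by rewrite ifN ?big_ord0.
move/eqP=> sum_n0; case: (boolP [exists k : 'I_(sy y),
    cobd (cochain i.+1) (map (shift (- k%:R)) y) != 0]); last first.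
  move/existsPn=> all0; case: sum_n0; rewrite big1 // => k _.
  by apply/eqP; have := all0 k; rewrite negbK.
case/existsP=> k /cobd_neq0[z zy [szz az]]; have gz := cochain_good z az.
have szz' : size z = i.+1 by move: szz; rewrite size_map szy => -[].
(* Here [i.+1] is odd, so [cochain i.+1] is supported on sign 0; shifting [z] back by [k] gives a
   subsequence of [y] of sign [k < sy y]. *)
have szk : s [set x in map (shift k%:R) z] = k%:R.
  rewrite sy_shift ?szz' //; suff -> : sy z = 0 by rewrite add0r.
  apply/eqP; apply: contraNT az => /negbTE sz0.
  by rewrite cochainS // sz0 -[odd _]negbK ei.
apply: (step (map (shift k%:R) z)).
- by have := map_subseq (shift k%:R) zy; rewrite map_shiftD addNr map_shift0.
- by rewrite size_map.
- by rewrite set_map l_shift; [apply: IHi | case/andP: gz].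
have val_k : nat_of_ord (k%:R : F) = k.
  by rewrite Zp_nat /= modn_small // (ltn_trans (ltn_ord k)).
by rewrite szk; apply/eqP => E; have := ltn_ord k; rewrite -[X in (X < _)%N]val_k E ltnn.
Qed.

Lemma antisym_cochain i : antisym (cochain i).
Proof.
elim: i => [|i IHi] y1 a b y2; first by case: y1 => [|x y1]; rewrite /cochain oppr0.
have E := perm_swap y1 y2 a b.
have [gy|ngy] := boolP (good (y1 ++ a :: b :: y2)); last first.
  by rewrite !cochain_bad ?oppr0 // -(perm_good E).
rewrite !cochainS // -?(perm_good E) // -(perm_set E).
have cA := antisym_cobd IHi.
case: (odd i.+1); first by case: ifP; rewrite ?oppr0 // cA.
by rewrite -sumrN; apply: eq_bigr => k _; rewrite !map_cat /= cA.
Qed.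

(** * Symmetrization over the block permutations *)

Definition permT (u : {perm V}) (x : T) : T := (u x.1, x.2).

Lemma good_perm u y : u \in block_perms blk -> good y -> good (map (permT u) y).
Proof.
move=> /block_permsP uG /andP[uy fy]; rewrite /good map_inj_uniq ?uy; last first.
  by case=> v g [w h] [] /perm_inj-> ->.
rewrite set_map; apply: face_imset fy => //= x x'; first exact: perm_inj.
by rewrite !uG.
Qed.

Lemma map_permT u w y :
  map (permT w) (map (permT u) y) = map (permT (u * w)%g) y.
Proof. by rewrite -map_comp; apply: eq_map => x; rewrite /permT /= permM. Qed.

Lemma map_permT1 y : map (permT 1%g) y = y.
Proof. by rewrite -[RHS]map_id; apply: eq_map => -[v g]; rewrite /permT perm1. Qed.

Lemma good_permE u y : u \in block_perms blk -> good (map (permT u) y) = good y.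
Proof.
move=> uG; apply/idP/idP; last exact: good_perm.
by move/(good_perm (groupVr uG)); rewrite map_permT mulgV map_permT1.
Qed.

(** A sum rather than an average: the order of the group reappears as the value in
    [ev_symcochain]. *)
Definition symcochain i y : F :=
  if good y then \sum_(u in block_perms blk) cochain i (map (permT u) y) else 0.

Lemma symcochain_bad i y : ~~ good y -> symcochain i y = 0.
Proof. by rewrite /symcochain => /negbTE->. Qed.

Lemma antisym_symcochain i : antisym (symcochain i).
Proof.
move=> y1 a b y2; rewrite /symcochain (perm_good (perm_swap y1 y2 a b)).
case: ifP => _; last by rewrite oppr0.
by rewrite -sumrN; apply: eq_bigr => u _; rewrite !map_cat /= antisym_cochain.
Qed.

Lemma symcochain_perm i u y : u \in block_perms blk ->
  symcochain i (map (permT u) y) = symcochain i y.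
Proof.
move=> uG; rewrite /symcochain good_permE //; case: ifP => // _.
rewrite [RHS](reindex_inj (mulgI u)) /=; apply: eq_big => [w|w _].
  by rewrite groupMl.
by rewrite map_permT.
Qed.

Lemma resop_sum i (I : Type) (r : seq I) (P : pred I) (f : I -> seq T -> F) y :
  resop i (fun z => \sum_(u <- r | P u) f u z) y =
  \sum_(u <- r | P u) resop i (f u) y.
Proof.
case: i => // i; rewrite /resop; case: (odd _); last by rewrite sumrB.
by rewrite exchange_big.
Qed.

Lemma resop_perm i f u y :
  resop i (fun z => f (map (permT u) z)) y = resop i f (map (permT u) y).
Proof.
have E t : map (permT u) (map (shift t) y) = map (shift t) (map (permT u) y).
  by rewrite -!map_comp.
case: i => // i; rewrite /resop E; case: (odd _) => //.
by apply: eq_bigr => t _; rewrite E.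
Qed.

(** The relation extends from faces to all sequences over distinct points. In a sequence that is not
    a face, two entries share block and value. Only the deletions of one of these two can
    contribute, and the transposition of their points makes both terms cancel; the right side
    vanishes since no shift is a face. *)
Lemma cobd_symcochain i y : uniq (unzip1 y) -> size y = i.+1 ->
  cobd (symcochain i) y = resop i.+1 (symcochain i.+1) y.
Proof.
move=> u1y szy; have [gy|ngy] := boolP (good y).
  pose h j z := \sum_(u in block_perms blk) cochain j (map (permT u) z).
  rewrite (@cobd_ext _ _ _ (h i)) => [|z zy _]; last first.
    by rewrite /symcochain (good_subseq zy).
  rewrite (@resop_ext _ _ (h i.+1)) => [|t].
    rewrite resop_sum cobd_sum; apply: eq_bigr => u uG.
    by rewrite resop_perm -cobd_map cobd_cochain ?size_map // good_perm.
  by rewrite /symcochain good_shiftE gy.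
rewrite (@resop_ext _ _ (fun=> 0)) => [|t]; last first.
  by rewrite symcochain_bad // good_shiftE.
have -> : resop i.+1 (fun=> 0) y = 0.
  by rewrite /resop; case: (odd _); rewrite ?big1 ?subr0.
have uy : uniq y := map_uniq u1y.
move: (ngy); rewrite /good uy negb_forall_in => /exists_inP[a ya].
rewrite negb_forall_in => /exists_inP[b yb]; rewrite negb_imply => /andP[Eab aNb].
rewrite !inE in ya yb; have sA := antisym_symcochain i.
have [z yz E] := antisym_move2 (antisym_cobd sA) ya yb aNb.
apply/eqP; rewrite {}E.
have: uniq (unzip1 (a :: b :: z)) by rewrite -(perm_uniq (perm_map fst yz)).
rewrite /= inE negb_or => /and3P[/andP[a1Nb1 a1z] b1z _].
move: Eab; rewrite (negbTE a1Nb1) /= => /andP[/eqP Eblk /eqP Esgn].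
rewrite (@cobd_ext _ _ _ (fun=> 0) z) => [|w _ _]; last first.
  apply: symcochain_bad; apply: contra aNb => /andP[_ /faceP[_ inj_blk]].
  by apply/eqP/inj_blk; rewrite ?inE ?eqxx ?orbT.
rewrite cobd0 subr0 subr_eq0 -(@symcochain_perm i (tperm a.1 b.1) (b :: z)).
  apply/eqP; congr symcochain; rewrite /= {1}/permT tpermR -Esgn -surjective_pairing.
  congr (_ :: _); rewrite -[RHS]map_id; apply/eq_in_map => x xz.
  rewrite /permT tpermD -?surjective_pairing //.
    by apply: contraNneq a1z => ->; apply: map_f.
  by apply: contraNneq b1z => ->; apply: map_f.
by apply/block_permsP => v; case: tpermP => [->|->|].
Qed.

(** * Evaluation on explicit cones, and the Tucker-type lemma *)

Lemma resop0 i y : resop i (fun=> 0) y = 0.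
Proof. by case: i => // i; rewrite /resop; case: (odd _); rewrite ?big1 ?subr0. Qed.

(* Evaluation of a cochain at the chain [h_i] given by [h_0 = [::]] and
   [h_(i+1) = (v, 0) * resop i h_i], where [*] is the join; its boundary is
   [resop i h_i]. *)
Fixpoint ev (vs : seq V) (f : seq T -> F) : F :=
  if vs is v :: vs' then ev vs' (resop (size vs') (fun y => f ((v, 0) :: y)))
  else f [::].

Lemma ev_ext vs f g :
  (forall y, unzip1 y = vs -> f y = g y) -> ev vs f = ev vs g.
Proof.
elim: vs f g => [|v vs IHvs] f g fg /=; first exact: fg.
apply: IHvs => y Ey; apply: resop_ext => t; apply: fg.
by rewrite /= /unzip1 -map_comp -Ey.
Qed.

Lemma ev0 vs : ev vs (fun=> 0) = 0.
Proof.
elim: vs => //= v vs IHvs; rewrite -[RHS]IHvs; apply: ev_ext => y _.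
exact: resop0.
Qed.

Lemma evB vs f g : ev vs (fun y => f y - g y) = ev vs f - ev vs g.
Proof.
elim: vs f g => //= v vs IHvs f g; rewrite -IHvs; apply: ev_ext => y _.
exact: resopB.
Qed.

(** Stokes' formula: the boundary of a cone is its base minus the cone over the boundary of the
    base, and this last term vanishes because consecutive operators compose to zero. *)
Lemma ev_cobd v vs f : ev (v :: vs) (cobd f) = ev vs (resop (size vs) f).
Proof.
elim: vs v f => [|w vs IHvs] v f; first by rewrite /= subr0.
rewrite -[LHS]/(ev (w :: vs) (resop (size vs).+1 (fun y => f y -
  cobd (fun z => f ((v, 0) :: z)) y))).
set g := fun z => f _.
rewrite (@ev_ext _ _ (fun y => resop (size vs).+1 f y -
  resop (size vs).+1 (cobd g) y)) => [|y _]; last exact: resopB.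
rewrite evB [X in _ - X](_ : _ = 0) ?subr0 //.
rewrite (@ev_ext _ _ (cobd (resop (size vs).+1 g))) => [|y _]; last first.
  by rewrite cobd_resop.
rewrite IHvs; case: vs {IHvs} => [|u vs].
  (* At the bottom of the recursion, the norm of a constant is [p] times it, zero in characteristic
     [p]. *)
  by rewrite /= sumr_const card_Fp // mulrn_pchar // pchar_Fp.
rewrite -[RHS](ev0 (u :: vs)); apply: ev_ext => y _.
exact: resop_resop.
Qed.

Hypothesis blk_small : forall v, (#|[set u | blk u == blk v]| < p)%N.

(** Alternating [ev_cobd] and [cobd_symcochain] removes the points one by one, down to the empty
    sequence, where each permutation contributes 1. *)
Lemma ev_symcochain vs : uniq vs ->
  ev vs (resop (size vs) (symcochain (size vs))) = #|block_perms blk|%:R.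
Proof.
elim: vs => [|v vs IHvs] u_vs.
  rewrite /= /symcochain ifT; last by rewrite /good; apply/faceP; split=> x; rewrite inE.
  by rewrite /cochain /= sumr_const.
rewrite -IHvs; last by case/andP: u_vs.
rewrite -[RHS](ev_cobd v); apply: ev_ext => y Ey.
by rewrite cobd_symcochain ?Ey // -(size_map fst) -/unzip1 Ey.
Qed.

(** If [N < #|V|], no face reaches level [#|V|], so by [cochain_neq0] the top cochain evaluates to
    0; but that value is the order of a group of order prime to [p]. *)
Theorem equivariant_level_bound (l : {set T} -> nat) (N : nat) :
  (forall X, face X -> X != set0 -> 0 < l X)%N ->
  (forall t X, face X -> l (shift t @: X) = l X) ->
  (forall X X', X \subset X' -> X != set0 -> face X' ->
     (l X < l X')%N \/ l X = l X' /\ s X = s X') ->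
  (forall X, face X -> l X <= N)%N ->
  (#|V| <= N)%N.
Proof.
move=> l_gt0 l_shift l_mono l_le; rewrite leqNgt; apply/negP => ltNV.
have /negP[] := block_perms_coprime p_pr blk_small.
rewrite (dvdn_pcharf (pchar_Fp p_pr)) -(ev_symcochain (enum_uniq V)) -cardE.
apply/eqP; rewrite -[RHS](ev0 (enum V)); apply: ev_ext => y Ey.
rewrite -[RHS](resop0 #|V| y); apply: resop_ext => t.
have [gy|ngy] := boolP (good (map (shift t) y)); last exact: symcochain_bad.
rewrite /symcochain gy big1 // => u uG.
have gz : good (map (permT u) (map (shift t) y)) by rewrite good_permE.
have fz := gz; move: fz => /andP[_ /l_le].
apply: contraTeq => /(cochain_neq0 l_gt0 l_shift l_mono gz) l_ge.
rewrite -ltnNge (leq_trans ltNV) // l_ge // !size_map.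
by rewrite -(size_map fst) -/unzip1 Ey -cardE.
Qed.

End EquivariantCochains.

(** * Runs of a word *)

Section Runs.

Variable G : eqType.
Implicit Types (o : option G) (w : seq G).

(** [o] is the letter preceding [w]; with [None] the first letter always opens a run. *)
Fixpoint runs o w : nat :=
  if w is g :: w' then (o != Some g) + runs (Some g) w' else 0.

Lemma runs_swap a b w : (runs (Some a) w <= (a != b) + runs (Some b) w)%N.
Proof.
case: w => //= g w; rewrite addnA leq_add2r.
rewrite -![Some _ == _]/(_ == _).
by case: (eqVneq a b) => [-> //|_]; case: (a != g).
Qed.

Lemma runs_subseq a w w' : subseq w w' -> (runs (Some a) w <= runs (Some a) w')%N.
Proof.
elim: w' a w => [|b w' IHw'] a w; first by rewrite subseq0 => /eqP->.
case: w => // c w /=; have [-> /IHw'|_ /IHw' sub] := eqVneq c b.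
  by rewrite leq_add2l.
exact: leq_trans (runs_swap a b (c :: w)) (leq_add (leqnn _) (sub b)).
Qed.

(** If the first letters differ, [w] embeds in the tail of [w'], and the first letter of [w'] opens
    an additional run. *)
Lemma runs_None_subseq w w' : subseq w w' -> w != [::] ->
  (runs None w < runs None w')%N \/
  runs None w = runs None w' /\ ohead w = ohead w'.
Proof.
case: w' w => [|b w'] [|a w] //=; have [<- sub _|aNb sub _] := eqVneq a b.
  have := runs_subseq a sub; rewrite leq_eqVlt => /orP[/eqP->|]; first by right.
  by left; rewrite ltn_add2l.
by left; rewrite !add1n ltnS; have /= := runs_subseq b sub; rewrite eq_sym aNb.
Qed.

Lemma runs_None_le w w' : subseq w w' -> (runs None w <= runs None w')%N.
Proof.
case: w => // a w sub.
by have [|/ltnW //|[-> _]] := @runs_None_subseq (a :: w) w' sub.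
Qed.

Lemma runs_map (h : G -> G) o w : injective h ->
  runs (omap h o) (map h w) = runs o w.
Proof.
move=> h_inj; elim: w o => //= g w IHw o; rewrite -(IHw (Some g)) /=.
congr (_ + _)%N; case: o => //= a; congr (nat_of_bool (~~ _)).
by rewrite -[LHS]/(h a == h g) (inj_eq h_inj).
Qed.

(* Every run of the subsequence of defined values starts at a defined value
   which differs from the entry just before it. *)
Lemma runs_pmap_le (s : seq (option G)) prev o :
  prev = None \/ prev = o ->
  (runs o (pmap id s) <= \sum_(i < size s)
     ((nth None s i != None) && (nth None s i != nth None (prev :: s) i)))%N.
Proof.
elim: s prev o => [|x s IHs] prev o Hprev //=; rewrite big_ord_recl /=.
case: x => [g|] /=; last by rewrite add0n; apply: (IHs None); left.
apply: leq_add; last by apply: (IHs (Some g)); right.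
by case: Hprev => ->; rewrite ?leq_b1 // eq_sym.
Qed.

Lemma subseq_pmap (A : Type) (h h' : A -> option G) (s : seq A) :
  (forall a g, h a = Some g -> h' a = Some g) ->
  subseq (pmap h s) (pmap h' s).
Proof.
move=> hh'; elim: s => //= a s IHs.
case E: (h a) => [g|] /=; first by rewrite (hh' _ _ E) /= eqxx.
by case: (h' a) => // g; apply: subseq_trans IHs (subseq_cons _ _).
Qed.

End Runs.

(** * Words of faces, and stable sets obtained from many runs *)

Section Signs.

Variables (p n : nat).
Hypothesis p_pr : prime p.
Local Notation F := 'F_p.
Local Notation T := ('I_n * 'F_p)%type.
Implicit Types (X : {set T}) (g : F).

Definition layer X g : {set 'I_n} := [set v | (v, g) \in X].

Definition sgn_at X (v : 'I_n) : option F := [pick g | (v, g) \in X].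

Definition word X : seq F := pmap (sgn_at X) (enum 'I_n).

Definition functional X := {in X &, forall x x', x.1 = x'.1 -> x = x'}.

Lemma sgn_at_mem X v g : sgn_at X v = Some g -> (v, g) \in X.
Proof. by rewrite /sgn_at; case: pickP => // h ? [<-]. Qed.

Lemma mem_sgn_at X v g : functional X -> (v, g) \in X -> sgn_at X v = Some g.
Proof.
move=> fX Xg; rewrite /sgn_at; case: pickP => [h Xh|/(_ g)]; last by rewrite Xg.
by have [->] := fX _ _ Xh Xg erefl.
Qed.

Lemma word_subseq X X' : X \subset X' -> functional X' ->
  subseq (word X) (word X').
Proof.
move=> /subsetP sub fX'; apply: subseq_pmap => v g /sgn_at_mem/sub.
exact: mem_sgn_at.
Qed.

Lemma word_neq0 X : functional X -> X != set0 -> word X != [::].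
Proof.
move=> fX /set0Pn[[v g] Xvg]; have: g \in word X.
  by rewrite mem_pmap; apply/mapP; exists v; rewrite ?mem_enum ?(mem_sgn_at fX Xvg).
by case: (word X).
Qed.

Lemma mem_shift t X v g : ((v, g) \in shift t @: X) = ((v, g - t) \in X).
Proof.
apply/imsetP/idP => [[[w h] Xwh [-> ->]]|Xvg]; first by rewrite addrK.
by exists (v, g - t); rewrite // /shift subrK.
Qed.

Lemma layer_shift t X g : layer (shift t @: X) g = layer X (g - t).
Proof. by apply/setP => v; rewrite !inE mem_shift. Qed.

Lemma word_shift t X : functional X -> word (shift t @: X) = map (+%R^~ t) (word X).
Proof.
move=> fX; rewrite /word; elim: (enum 'I_n) => //= v s ->.
suff -> : sgn_at (shift t @: X) v = omap (+%R^~ t) (sgn_at X v).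
  by case: (sgn_at X v).
rewrite /sgn_at; case: pickP => [g|noX].
  by rewrite mem_shift => /(mem_sgn_at fX); rewrite /sgn_at => ->; rewrite /= subrK.
case: pickP => //= g Xg.
by have := noX (g + t); rewrite mem_shift addrK Xg.
Qed.

(** By pigeonhole, [k] of the run starts carry the same value [g]. Two consecutive points of equal
    value cannot both be run starts, so these [k] points are almost 2-stable. *)
Lemma stable_of_runs X k : (0 < k)%N -> (p * k.-1 < runs None (word X))%N ->
  exists g, exists2 A : {set 'I_n}, #|A| = k & almost_2stable A && (A \subset layer X g).
Proof.
move=> k_gt0 many; pose s := map (sgn_at X) (enum 'I_n).
have nth_s (v : 'I_n) : nth None s v = sgn_at X v.
  by rewrite (nth_map v) ?nth_ord_enum // size_enum_ord.
(* Prepending [None] shifts the indices: entry [v] of [None :: s] is the value just before [v]. *)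
pose S := [set v : 'I_n | (sgn_at X v != None) && (sgn_at X v != nth None (None :: s) v)].
have runs_le : (runs None (word X) <= #|S|)%N.
  have -> : word X = pmap id s by rewrite /word /s; elim: (enum _) => //= v u ->.
  apply: leq_trans (runs_pmap_le s (or_introl _ erefl)) _.
  rewrite size_map size_enum_ord -sum1_card [X in (_ <= X)%N]big_mkcond /=.
  by apply: leq_sum => v _; rewrite inE nth_s; case: (_ && _).
pose S_ g := [set v in S | sgn_at X v == Some g].
have [g Sg_ge] : exists g, (k <= #|S_ g|)%N.
  apply/existsP; apply: contraTT (leq_trans many runs_le) => /existsPn small.
  rewrite -leqNgt -sum1_card (partition_big (fun v => odflt 0 (sgn_at X v)) predT) //=.
  rewrite -[X in (_ <= X * _)%N](card_Fp p_pr) -sum_nat_const; apply: leq_sum => g _.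
  have := small g; rewrite -ltnNge -(prednK k_gt0) ltnS; apply: leq_trans.
  rewrite sum1_card; apply: subset_leq_card; apply/subsetP => v.
  rewrite unfold_in /= => /andP[vS]; rewrite inE vS /=; move: vS; rewrite inE.
  by case: (sgn_at X v) => //= h _ /eqP->.
have /card_geqP[u [uu sz_u sub]] := Sg_ge.
exists g; exists [set v in u]; first by rewrite cardsE (card_uniqP uu).
have S_u v : v \in [set v in u] -> sgn_at X v == Some g /\ v \in S.
  by rewrite inE => /sub; rewrite inE => /andP[vS Ev]; split.
apply/andP; split; last first.
  by apply/subsetP => v /S_u[/eqP /sgn_at_mem Xvg _]; rewrite inE.
apply/forall_inP => v /S_u[/eqP Ev vS]; apply/forall_inP => w /S_u[/eqP Ew wS].
have consec (a b : 'I_n) : sgn_at X a = sgn_at X b -> b \in S -> nat_of_ord b <> a.+1.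
  by move=> Eab bS Eb; move: bS; rewrite inE Eb /= nth_s Eab eqxx andbF.
apply: contraTneq isT => dvw.
have [ltvw|ltwv|/val_inj Evw] := ltngtP v w.
- by case: (consec v w); rewrite ?Ev ?Ew //; move: dvw; rewrite distnEr 1?ltnW //; lia.
- by case: (consec w v); rewrite ?Ev ?Ew //; move: dvw; rewrite distnEl 1?ltnW //; lia.
by rewrite Evw distnn in dvw.
Qed.

End Signs.

(** * Lower bound: level and sign of a face under a proper coloring *)

Section LowerBound.

Variables (r k n m : nat) (P : {set {set 'I_n}}) (f : {set 'I_n} -> nat).
Hypotheses (r_pr : prime r) (k_gt0 : (0 < k)%N).
Hypothesis partP : partition P [set: 'I_n].
Hypothesis smallP : forall C : {set 'I_n}, C \in P -> (#|C| <= r - 1)%N.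

Let H := induced (kneser_hypergraph r k n)
  [set A | almost_2stable A && partial_transversal P A].
Hypothesis f_col : proper_coloring H m f.

Local Notation F := 'F_r.
Local Notation T := ('I_n * 'F_r)%type.
Local Notation face := (face (pblock P)).
Implicit Types (X : {set T}) (g : F) (A : {set 'I_n}).

Lemma vertexE A : (A \in vertices H) =
  [&& #|A| == k, almost_2stable A & partial_transversal P A].
Proof. by rewrite !inE. Qed.

Lemma face_functional X : face X -> functional X.
Proof. by case/faceP. Qed.

Lemma pblock_small v : (#|[set u | pblock P u == pblock P v]| < r)%N.
Proof.
have /and3P[/eqP covP _ _] := partP.
have le_r : (#|pblock P v| <= r - 1)%N by rewrite smallP // pblock_mem // covP.
rewrite -(prednK (prime_gt0 r_pr)) ltnS -subn1; apply: leq_trans le_r.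
apply: subset_leq_card; apply/subsetP => u; rewrite inE => /eqP <-.
by rewrite mem_pblock covP.
Qed.

Lemma layer_transversal X g A :
  face X -> A \subset layer X g -> partial_transversal P A.
Proof.
have /and3P[_ triP _] := partP.
move=> /faceP[_ inj_blk] /subsetP sub; apply/forall_inP => C PC.
apply/card_le1_eqP => u v /setIP[/sub Xu Cu] /setIP[/sub Xv Cv].
rewrite !inE in Xu Xv.
have /= := inj_blk _ _ Xu Xv; rewrite !(def_pblock triP PC) //.
by case/(_ erefl erefl).
Qed.

Definition colors X (c : nat) : {set F} :=
  [set g | [exists A, [&& A \in vertices H, A \subset layer X g & f A == c]]].

Lemma colorsP X c g :
  reflect (exists2 A, A \in vertices H & A \subset layer X g /\ f A = c)
          (g \in colors X c).
Proof.
rewrite inE; apply: (iffP existsP) => [[A /and3P[HA sub /eqP Ec]]|[A HA [sub Ec]]].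
  by exists A.
by exists A; rewrite HA sub Ec eqxx.
Qed.

Lemma colors_sub X X' c : X \subset X' -> colors X c \subset colors X' c.
Proof.
move=> /subsetP sub; apply/subsetP => g /colorsP[A HA [subA Ec]].
apply/colorsP; exists A => //; split=> //; apply: subset_trans subA _.
by apply/subsetP => v; rewrite !inE; apply: sub.
Qed.

Lemma colors_shift t X c : colors (shift t @: X) c = (fun g => g + t) @: colors X c.
Proof.
apply/setP => g; apply/colorsP/imsetP => [[A HA []]|[h /colorsP[A HA [sub Ec]] ->]].
  rewrite layer_shift => sub Ec; exists (g - t); last by rewrite subrK.
  by apply/colorsP; exists A.
by exists A; rewrite // layer_shift addrK.
Qed.

(** Otherwise all [r] fibers, which are pairwise disjoint, contain a vertex of color [c]: a
    monochromatic hyperedge. *)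
Lemma colors_ltr X c : face X -> (#|colors X c| < r)%N.
Proof.
move=> fX; rewrite -[X in (_ < X)%N](card_Fp r_pr) ltn_neqAle max_card andbT.
apply/negP => /eqP full.
have allc g : exists A, [&& A \in vertices H, A \subset layer X g & f A == c].
  have colT : colors X c = setT.
    by apply/eqP; rewrite eqEcard subsetT cardsT full leqnn.
  have: g \in colors X c by rewrite colT inE.
  by rewrite inE => /existsP.
pose A_ g := xchoose (allc g).
have A_P g : [&& A_ g \in vertices H, A_ g \subset layer X g & f (A_ g) == c].
  exact: (xchooseP (allc g)).
have A_n0 g : A_ g != set0.
  have /and3P[+ _ _] := A_P g; rewrite vertexE -card_gt0 => /and3P[/eqP-> _ _].
  exact: k_gt0.
have A_disj g h : g != h -> [disjoint A_ g & A_ h].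
  move=> gNh; apply/pred0P => v /=; apply: contraNF gNh => /andP[Agv Ahv].
  have /and3P[_ /subsetP/(_ v Agv) + _] := A_P g.
  have /and3P[_ /subsetP/(_ v Ahv) + _] := A_P h.
  by rewrite !inE => Xh Xg; have [->] := face_functional fX Xg Xh erefl.
(* Disjoint nonempty sets are distinct, so the hyperedge has exactly [r] members. *)
have A_inj : injective A_.
  move=> g h E; apply/eqP; apply: contraT => /A_disj.
  by rewrite E -setI_eq0 setIid (negbTE (A_n0 h)).
have [_ /(_ (A_ @: setT))] := f_col; case.
  have sub_vertices : A_ @: setT \subset vertices H.
    by apply/subsetP => _ /imsetP[g _ ->]; case/and3P: (A_P g).
  move: sub_vertices; rewrite subsetI => /andP[sub1 sub2].
  rewrite !inE sub1 sub2 card_imset // cardsT (card_Fp r_pr) eqxx andbT /=.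
  apply/trivIsetP => _ _ /imsetP[g _ ->] /imsetP[h _ ->] AN.
  by apply: A_disj; apply: contraNneq AN => ->.
move=> _ _ /imsetP[g _ ->] /imsetP[h _ ->].
by have /and3P[_ _ /eqP->] := A_P g; have /and3P[_ _ /eqP->] := A_P h.
Qed.

(** The cap on the runs sits where [colors_of_runs] starts to provide a nonempty color set, which
    then takes over the definition of [sign]. *)
Definition level X : nat :=
  (minn (runs None (word X)) (r * k.-1) + \sum_(c < m) #|colors X c|)%N.

(* The average is equivariant since [0 < #|colors X c| < r] is invertible
   mod [r]. *)
Definition sign X : F :=
  if [pick c : 'I_m | colors X c != set0] is Some c
  then (\sum_(g in colors X c) g) / #|colors X c|%:R
  else odflt 0 (ohead (word X)).

Lemma colors_of_runs X : face X -> (r * k.-1 < runs None (word X))%N ->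
  exists c : 'I_m, colors X c != set0.
Proof.
move=> fX /(stable_of_runs r_pr k_gt0)[g [A cardA /andP[stA subA]]].
have HA : A \in vertices H.
  by rewrite vertexE cardA eqxx stA (layer_transversal fX subA).
have [/(_ A HA) fA _] := f_col; exists (Ordinal fA).
by apply/set0Pn; exists g; apply/colorsP; exists A.
Qed.

Lemma sign_shift t X : face X -> X != set0 -> sign (shift t @: X) = sign X + t.
Proof.
move=> fX X_n0; rewrite /sign.
have E c : (colors (shift t @: X) c != set0) = (colors X c != set0).
  by rewrite colors_shift -!card_gt0 card_imset //; apply: addIr.
rewrite (eq_pick (fun c : 'I_m => E c)); case: pickP => [c c_n0|_].
  rewrite colors_shift big_imset /=; last by move=> ? ? _ _ /addIr.
  rewrite card_imset; last exact: addIr.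
  rewrite big_split /= sumr_const mulrDl -[t *+ _]mulr_natr mulfK //.
  rewrite -(dvdn_pcharf (pchar_Fp r_pr)) gtnNdvd ?card_gt0 //.
  exact: colors_ltr.
have := word_neq0 (face_functional fX) X_n0.
by rewrite (word_shift _ (face_functional fX)); case: (word X).
Qed.

Lemma level_gt0 X : face X -> X != set0 -> (0 < level X)%N.
Proof.
move=> fX X_n0; rewrite /level addn_gt0 leq_min.
have runs_gt0 : (0 < runs None (word X))%N.
  by have := word_neq0 (face_functional fX) X_n0; case: (word X).
rewrite runs_gt0 /=; case: posnP => //= rk0.
(* When the cap is 0, that is [k = 1], a single run already gives a nonempty color set. *)
have [|c c_n0] := colors_of_runs fX; first by rewrite rk0.
by rewrite (bigD1 c) //= addn_gt0 card_gt0 c_n0.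
Qed.

Lemma level_shift t X : face X -> level (shift t @: X) = level X.
Proof.
move=> fX; rewrite /level (word_shift _ (face_functional fX)).
rewrite (@runs_map _ (+%R^~ t) None) //; last exact: addIr.
congr (_ + _)%N; apply: eq_bigr => c _.
by rewrite colors_shift card_imset //; apply: addIr.
Qed.

(** Equal levels force equality of both summands, hence of the nested color sets. A nonempty one
    gives equal signs. If all are empty, neither face exceeds the cap, so the run counts agree and
    the words start with the same letter. *)
Lemma level_mono X X' : X \subset X' -> X != set0 -> face X' ->
  (level X < level X')%N \/ level X = level X' /\ sign X = sign X'.
Proof.
move=> sub X_n0 fX'; have fX := face_sub sub fX'.
have w_sub := word_subseq sub (face_functional fX').
have c_le (c : 'I_m) : (#|colors X c| <= #|colors X' c|)%N.
  exact/subset_leq_card/colors_sub.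
have min_le : (minn (runs None (word X)) (r * k.-1) <=
               minn (runs None (word X')) (r * k.-1))%N.
  by rewrite leq_min geq_minr geq_min (runs_None_le w_sub).
have sum_le : (\sum_(c < m) #|colors X c| <= \sum_(c < m) #|colors X' c|)%N.
  exact: leq_sum.
have := leq_add min_le sum_le; rewrite -/(level X) -/(level X') leq_eqVlt.
case/orP=> [/eqP E|]; [right; split=> // | by left].
have sumE : (\sum_(c < m) #|colors X c| = \sum_(c < m) #|colors X' c|)%N.
  by move: E min_le sum_le; rewrite /level; lia.
have minE : minn (runs None (word X)) (r * k.-1) =
            minn (runs None (word X')) (r * k.-1).
  by move: E; rewrite /level sumE => /addIn.
have cE (c : 'I_m) : colors X c = colors X' c.
  apply/eqP; rewrite eqEcard colors_sub //=.
  have /(_ predT)/esym := (leqif_sum (fun c _ => leqif_eq (c_le c))).2.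
  by rewrite sumE eqxx => /forall_inP/(_ c isT)/eqP->.
rewrite /sign; have E' (c : 'I_m) : (colors X c != set0) = (colors X' c != set0) by rewrite cE.
rewrite (eq_pick E'); case: pickP => [c _|none]; first by rewrite cE.
have few Y : face Y -> (forall c : 'I_m, colors Y c = colors X' c) ->
    (runs None (word Y) <= r * k.-1)%N.
  move=> fY Ec; rewrite leqNgt; apply/negP => /(colors_of_runs fY)[c].
  by rewrite Ec none.
have [|[_ ->//]] := runs_None_subseq w_sub (word_neq0 (face_functional fX) X_n0).
by move: minE; rewrite !(minn_idPl _) ?few // => ->; rewrite ltnn.
Qed.

Lemma coloring_lower_bound : (n <= r * k.-1 + m * (r - 1))%N.
Proof.
rewrite -[n in (n <= _)%N]card_ord.
apply: (equivariant_level_bound r_pr sign_shift pblock_small level_gt0 level_shift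
  level_mono) => X fX.
rewrite /level leq_add ?geq_minr // -[m in (m * _)%N]card_ord -sum_nat_const.
by apply: leq_sum => c _; have := colors_ltr c fX; lia.
Qed.

End LowerBound.

(** * Upper bound: coloring by blocks of minima *)

Section UpperBound.

Variables (r k n c : nat).
Hypotheses (r_gt1 : (1 < r)%N) (k_gt0 : (0 < k)%N) (c_gt0 : (0 < c)%N).
Hypothesis n_le : (n <= r * k.-1 + c * (r - 1))%N.
Implicit Types A : {set 'I_n}.

Definition min_elt A : nat :=
  if [pick v in A] is Some v0 then [arg min_(v < v0 in A) v] : nat else 0.

Lemma min_eltP A : A != set0 ->
  (exists2 v : 'I_n, v \in A & min_elt A = v) /\
  (forall v : 'I_n, v \in A -> (min_elt A <= v)%N).
Proof.
case/set0Pn=> w Aw; rewrite /min_elt; case: pickP => [v Av|/(_ w)]; last by rewrite Aw.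
by case: arg_minnP => // u Au u_min; split=> //; exists u.
Qed.

Definition block_coloring A : nat := minn (min_elt A %/ (r - 1)) c.-1.

(** Disjoint sets have distinct minima. For a color below [c.-1], [r] minima would share [r - 1]
    consecutive integers. For the last color, [r] disjoint [k]-sets would lie above
    [c.-1 * (r - 1)], where at most [r * k - 1] points remain. *)
Lemma block_coloringP : proper_coloring (kneser_hypergraph r k n) c block_coloring.
Proof.
split=> [A _|e]; first by rewrite /block_coloring -{2}(prednK c_gt0) ltnS geq_minr.
rewrite inE => /and3P[/subsetP e_sub /eqP card_e triv_e] mono.
have cardA A : A \in e -> #|A| = k by move/e_sub; rewrite inE => /eqP.
have e_n0 A : A \in e -> A != set0 by move/cardA=> cA; rewrite -card_gt0 cA.
have [A0 eA0] : exists A0, A0 \in e by apply/set0Pn; rewrite -card_gt0 card_e ltnW.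
have d_gt0 : (0 < r - 1)%N by rewrite subn_gt0.
have colE A : A \in e -> block_coloring A = block_coloring A0 by move=> eA; apply: mono.
have min_inj : {in e &, injective min_elt}.
  move=> A B eA eB EAB; apply/eqP; apply: contraT => ANB.
  have [[v Av Ev] _] := min_eltP (e_n0 A eA).
  have [[w Bw Ew] _] := min_eltP (e_n0 B eB).
  have /pred0P/(_ v)/= := trivIsetP triv_e A B eA eB ANB.
  by rewrite Av (_ : v = w) ?Bw //; apply: val_inj; rewrite /= -Ev -Ew.
have [lt_c|ge_c] := ltnP (block_coloring A0) c.-1.
  set q := block_coloring A0 in lt_c.
  have qE A : A \in e -> (min_elt A %/ (r - 1))%N = q.
    move=> /colE; rewrite -/q /block_coloring.
    by move: (min_elt A %/ _)%N lt_c => x; lia.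
  have: (size (map min_elt (enum e)) <= size (iota (q * (r - 1)) (r - 1)))%N.
    apply: uniq_leq_size => [|i /mapP[A]].
      by rewrite map_inj_in_uniq ?enum_uniq // => A B; rewrite !mem_enum; apply: min_inj.
    rewrite mem_enum mem_iota => /qE <- ->; rewrite leq_divM /=.
    by rewrite -mulSnr ltn_ceil.
  by rewrite size_map size_iota -cardE card_e; lia.
have ge_L (v : 'I_n) : v \in cover e -> (c.-1 * (r - 1) <= v)%N.
  case/bigcupP=> A eA Av; have [_ /(_ v Av)] := min_eltP (e_n0 A eA).
  apply: leq_trans; rewrite -leq_divRL //.
  by apply: leq_trans ge_c _; rewrite -(colE A eA) geq_minl.
have : (size (map val (enum (cover e))) <= size (iota (c.-1 * (r - 1)) (n - c.-1 * (r - 1))))%N.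
  apply: uniq_leq_size => [|i /mapP[v]].
    by rewrite map_inj_uniq ?enum_uniq //; apply: val_inj.
  rewrite mem_enum mem_iota => /ge_L L_le ->; rewrite L_le subnKC ?ltn_ord //.
  exact: leq_trans L_le (ltnW (ltn_ord v)).
rewrite size_map size_iota -cardE -(eqP triv_e) (eq_bigr (fun=> k)) ?cardA //.
rewrite sum_nat_const card_e => le_rk.
have E1 : (c.-1 * (r - 1) + (r - 1) = c * (r - 1))%N by rewrite -mulSnr prednK.
have E2 : (r * k.-1 + r = r * k)%N by rewrite -mulnSr prednK.
by move: le_rk n_le E1 E2; lia.
Qed.

End UpperBound.

(** * The chromatic number *)

Lemma colorable_induced (U : finType) (K : hypergraph U) (W : {set U}) c :
  colorable K c -> colorable (induced K W) c.
Proof.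
case=> f [f_lt f_mono]; exists f; split=> [v /setIP[/f_lt]|e] //.
by rewrite inE => /andP[/f_mono].
Qed.

Lemma ceil_ratio (N d c : nat) : (0 < d)%N ->
  (N <= c * d)%N -> (c * d < N + d)%N -> c%:Z = Num.ceil (N%:Q / d%:Q).
Proof.
move=> d_gt0 le_cd lt_cd; have d_pos : 0 < d%:Q by rewrite ltr0z.
apply/esym/ceil_def; rewrite ler_pdivrMr // ltr_pdivlMr //.
rewrite -!intrM ltr_int ler_int; apply/andP; split; lia.
Qed.

Local Close Scope ring_scope.

Theorem theorem3p10 (r k n : nat) (P : {set {set 'I_n}}) :
  prime r -> 1 <= k -> r * k <= n ->
  partition P [set: 'I_n] ->
  (forall C : {set 'I_n}, C \in P -> #|C| <= r - 1) ->
  exists2 c : nat,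
    is_chromatic_number
      (induced (kneser_hypergraph r k n)
         [set s | almost_2stable s && partial_transversal P s]) c
    & (c%:Z = Num.ceil ((n%:Q - r%:Q * (k%:Q - 1)) / (r%:Q - 1)))%R.
Proof.
move=> r_pr k_gt0 rk_le_n partP smallP.
have r_gt1 := prime_gt1 r_pr.
(* [c] is the ceiling of [N / d]; the subtraction in [N] is exact because [r * k <= n]. *)
pose d := r - 1; pose N := n - r * k.-1; pose c := (N + d - 1) %/ d.
have d_gt0 : 0 < d by rewrite subn_gt0.
have rk_eq : r * k.-1 + r = r * k by rewrite -mulnSr prednK.
have cE := divn_eq (N + d - 1) d; have rem_lt := ltn_pmod (N + d - 1) d_gt0.
rewrite -/c in cE.
have N_le : N <= c * d by lia.
have lt_N : c * d < N + d by lia.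
(* Indeed [N >= r > 0]; the coloring needs a last color [c.-1]. *)
have c_gt0 : 0 < c by case: (c) N_le => // ; lia.
exists c; last first.
  rewrite (ceil_ratio d_gt0 N_le lt_N); congr (Num.ceil (_ / _))%R.
    have -> : (N%:Z = n%:Z - r%:Z * (k%:Z - 1))%R.
      by rewrite /N -subzn; [rewrite PoszM predn_int | lia].
    by rewrite !(intrB, intrM).
  by rewrite /d -subzn ?intrB // ltnW.
split=> [|c' [f f_col]].
  by apply/colorable_induced; exists (block_coloring r c); apply: block_coloringP => //; lia.
have := coloring_lower_bound r_pr k_gt0 partP smallP f_col => n_le.
(* The lower bound reads [N <= c' * d], while [c * d < N + d]. *)
have : c * d < c'.+1 * d by rewrite mulSn; lia.
by rewrite ltn_pmul2r.
Qed.
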